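(* Let $k$ be an infinite $C_1$ field with $\operatorname{char}k\neq2$. Let $\mathbb{P}(V^1_{8,4,4,0,0,0})\cong\mathbb{P}^{21}$ be the parameter space of conic bundles of multidegree $(8,4,4,0,0,0)$ in $\mathcal{T}_{4,0,0}$, let $\mathcal{U}\subset\mathbb{P}(V^1_{8,4,4,0,0,0})$ be the hyperplane $c_2=0$, and let $\mathcal{G}_{4,0,0}=\operatorname{Aut}(\mathcal{T}_{4,0,0})$. Then a general $\mathcal{Q}^1\in\mathcal{U}$ is rational over $k$, and the map $$\chi:\mathcal{G}_{4,0,0}\times\mathcal{U}\longrightarrow\mathbb{P}(V^1_{8,4,4,0,0,0}),\qquad(\varphi,\mathcal{Q}^1)\mapsto\varphi^*\mathcal{Q}^1,$$ has Zariski dense image.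
   Context: $\mathcal{T}_{4,0,0}=\mathbb{P}(\mathcal{O}_{\mathbb{P}^1}(4)\oplus\mathcal{O}_{\mathbb{P}^1}\oplus\mathcal{O}_{\mathbb{P}^1})$ is the toric variety with Cox ring $k[x_0,x_1,y_0,y_1,y_2]$, $\deg x_i=(1,0)$, $\deg y_0=(-4,1)$, $\deg y_1=\deg y_2=(0,1)$, irrelevant ideal $(x_0,x_1)\cap(y_0,y_1,y_2)$. Points of $\mathbb{P}(V^1_{8,4,4,0,0,0})$ are conic bundles $\{\sigma_{0,0}y_0^2+\sigma_{0,1}y_0y_1+\sigma_{0,2}y_0y_2+\sigma_{1,1}y_1^2+\sigma_{1,2}y_1y_2+\sigma_{2,2}y_2^2=0\}\subset\mathcal{T}_{4,0,0}$ up to scaling, with $\sigma_{0,0}=\sum_{i=0}^8a_ix_0^{8-i}x_1^i$, $\sigma_{0,1}=\sum_{i=0}^4b_ix_0^{4-i}x_1^i$, $\sigma_{0,2}=\sum_{i=0}^4d_ix_0^{4-i}x_1^i$, $\sigma_{1,1}=c_0$, $\sigma_{1,2}=c_1$, $\sigma_{2,2}=c_2$. The automorphisms of $\mathcal{T}_{4,0,0}$ are: $x_0\mapsto\alpha_{0,0}x_0+\alpha_{0,1}x_1$, $x_1\mapsto\alpha_{1,0}x_0+\alpha_{1,1}x_1$, $y_0\mapsto\beta_{0,0}y_0$, $y_j\mapsto\gamma_{j,1}y_1+\gamma_{j,2}y_2+\sum_{i=1}^5\delta_{j,i}x_0^{5-i}x_1^{i-1}y_0$ for $j=1,2$. A field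 is $C_1$ if every homogeneous form of degree $d>0$ in more than $d$ variables has a nontrivial zero. *)

(* Defs.v *)
From HB Require Import structures.
From mathcomp Require Import all_boot all_order all_algebra.
From mathcomp Require Import fraction mpoly.
Set Implicit Arguments.
Unset Strict Implicit.
Unset Printing Implicit Defensive.
Import GRing.Theory.
Local Open Scope ring_scope.

Definition infinite_field (k : fieldType) : Prop :=
  forall s : seq k, exists x : k, x \notin s.

Definition C1_field (k : fieldType) : Prop :=
  forall (d n : nat) (f : {mpoly k[n]}),
    (0 < d)%N -> (d < n)%N -> f \is d.-homog ->
    exists v : 'I_n -> k, (exists i, v i != 0) /\ f.@[v] = 0.

(* Points of P^n(k) are nonzero row vectors of length n + 1, up to scaling;
   a subset of P^n(k) is given by a predicate on such vectors. *)

Definition zariski_closed (k : fieldType) (n : nat) (Z : 'rV[k]_n.+1 -> Prop) :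
    Prop :=
  exists I : {mpoly k[n.+1]} -> Prop,
    (forall G, I G -> exists d : nat, G \is d.-homog) /\
    (forall v : 'rV[k]_n.+1,
        Z v <-> (v != 0 /\ forall G, I G -> G.@[fun i => v 0 i] = 0)).

Definition zariski_dense (k : fieldType) (n : nat) (A : 'rV[k]_n.+1 -> Prop) :
    Prop :=
  forall Z : 'rV[k]_n.+1 -> Prop, zariski_closed Z ->
    (forall v, A v -> Z v) -> forall v, v != 0 -> Z v.

(* For an irreducible U: P holds on a nonempty Zariski open subset of U. *)
Definition holds_generally_on (k : fieldType) (n : nat)
    (U P : 'rV[k]_n.+1 -> Prop) : Prop :=
  exists Z : 'rV[k]_n.+1 -> Prop,
    [/\ zariski_closed Z,
        exists2 v, U v & ~ Z v
      & forall v, U v -> ~ Z v -> P v].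

(* Coordinates x0, x1, y0, y1, y2 of the Cox ring of T_{4,0,0}. *)

Definition ix0 : 'I_5 := @Ordinal 5 0 isT.
Definition ix1 : 'I_5 := @Ordinal 5 1 isT.
Definition iy0 : 'I_5 := @Ordinal 5 2 isT.
Definition iy1 : 'I_5 := @Ordinal 5 3 isT.
Definition iy2 : 'I_5 := @Ordinal 5 4 isT.

Definition x0 (k : fieldType) : {mpoly k[5]} := 'X_ix0.
Definition x1 (k : fieldType) : {mpoly k[5]} := 'X_ix1.
Definition y0 (k : fieldType) : {mpoly k[5]} := 'X_iy0.
Definition y1 (k : fieldType) : {mpoly k[5]} := 'X_iy1.
Definition y2 (k : fieldType) : {mpoly k[5]} := 'X_iy2.
Arguments x0 {k}.
Arguments x1 {k}.
Arguments y0 {k}.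
Arguments y1 {k}.
Arguments y2 {k}.

Definition bideg (m : 'X_{1..5}) : int * int :=
  ((m ix0)%:Z + (m ix1)%:Z - 4%:Z * (m iy0)%:Z,
   (m iy0)%:Z + (m iy1)%:Z + (m iy2)%:Z).

Definition bihomog (k : fieldType) (e : int * int) (P : {mpoly k[5]}) : Prop :=
  forall m : 'X_{1..5}, m \in msupp P -> bideg m = e.

(* K, with k-structure iota, is the function field of the hypersurface
   {F = 0} of T_{4,0,0}.  The first condition makes (F) a prime ideal, i.e. the
   hypersurface integral, and embeds k[x0,x1,y0,y1,y2]/(F) in a field L; then K
   is k-isomorphic to the subfield of L consisting of the fractions of
   bihomogeneous elements of equal bidegree.  No saturation by the irrelevant
   ideal is needed, as its zero locus has codimension >= 2 in affine 5-space. *)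
Definition is_function_field (k : fieldType) (F : {mpoly k[5]})
    (K : fieldType) (iota : k -> K) : Prop :=
  exists (L : fieldType) (q : {rmorphism {mpoly k[5]} -> L})
         (j : {rmorphism K -> L}),
    [/\ forall P, q P = 0 <-> exists A, P = A * F,
        forall c : k, j (iota c) = q c%:MP
      & forall z : L, (exists u : K, z = j u) <->
          (exists (e : int * int) (P R : {mpoly k[5]}),
             [/\ bihomog e P, bihomog e R, q R != 0 & z = q P / q R])].

(* Birational over k to P^2: the function field is k(s, t) as a k-field. *)
Definition rational_surface (k : fieldType) (F : {mpoly k[5]}) : Prop :=
  @is_function_field k F {fraction {mpoly k[2]}}
    (fun c : k => FracField.tofrac (c%:MP : {mpoly k[2]})).

(* Coordinates on P(V^1_{8,4,4,0,0,0}) = P^21, in the order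
   a_0..a_8, b_0..b_4, d_0..d_4, c_0, c_1, c_2. *)
Definition coef_a (k : fieldType) (v : 'rV[k]_22) (i : nat) : k := v 0 (inord i).
Definition coef_b (k : fieldType) (v : 'rV[k]_22) (i : nat) : k :=
  v 0 (inord (9 + i)).
Definition coef_d (k : fieldType) (v : 'rV[k]_22) (i : nat) : k :=
  v 0 (inord (14 + i)).
Definition coef_c (k : fieldType) (v : 'rV[k]_22) (i : nat) : k :=
  v 0 (inord (19 + i)).

Definition conic_bundle (k : fieldType) (v : 'rV[k]_22) : {mpoly k[5]} :=
  (\sum_(i < 9) coef_a v i *: (x0 ^+ (8 - i) * x1 ^+ i)) * y0 ^+ 2
  + (\sum_(i < 5) coef_b v i *: (x0 ^+ (4 - i) * x1 ^+ i)) * (y0 * y1)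
  + (\sum_(i < 5) coef_d v i *: (x0 ^+ (4 - i) * x1 ^+ i)) * (y0 * y2)
  + coef_c v 0 *: y1 ^+ 2
  + coef_c v 1 *: (y1 * y2)
  + coef_c v 2 *: y2 ^+ 2.

Definition calU (k : fieldType) (v : 'rV[k]_22) : Prop :=
  v != 0 /\ coef_c v 2 = 0.

(* Rows and columns of gamma, and rows of delta, are indexed from 0:
   gamma j l is gamma_{j+1,l+1} and delta j i is delta_{j+1,i+1}. *)
Record autT400 (k : fieldType) := AutT400 {
  aut_alpha : 'M[k]_2;
  aut_beta : k;
  aut_gamma : 'M[k]_2;
  aut_delta : 'M[k]_(2, 5);
  aut_alpha_unit : aut_alpha \in unitmx;
  aut_beta_neq0 : aut_beta != 0;
  aut_gamma_unit : aut_gamma \in unitmx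
}.

Definition aut_x (k : fieldType) (phi : autT400 k) (j : 'I_2) : {mpoly k[5]} :=
  aut_alpha phi j 0 *: x0 + aut_alpha phi j 1 *: x1.

Definition aut_y (k : fieldType) (phi : autT400 k) (j : 'I_2) : {mpoly k[5]} :=
  aut_gamma phi j 0 *: y1 + aut_gamma phi j 1 *: y2
  + \sum_(i < 5) aut_delta phi j i *: (x0 ^+ (4 - i) * x1 ^+ i * y0).

Definition aut_pullback (k : fieldType) (phi : autT400 k) (F : {mpoly k[5]}) :
    {mpoly k[5]} :=
  F \mPo [tuple aut_x phi 0; aut_x phi 1; aut_beta phi *: y0;
                aut_y phi 0; aut_y phi 1].

(* The graph of chi: [w] = phi^*[v], equations being taken up to scaling. *)
Definition chi_graph (k : fieldType) (phi : autT400 k) (v w : 'rV[k]_22) :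
    Prop :=
  exists2 c : k, c != 0 &
    conic_bundle w = c *: aut_pullback phi (conic_bundle v).

Definition chi_image (k : fieldType) (w : 'rV[k]_22) : Prop :=
  exists (phi : autT400 k) (v : 'rV[k]_22), calU v /\ chi_graph phi v w.

(* Main.v *)
Require Import Defs.
From HB Require Import structures.
From mathcomp Require Import all_boot all_order all_algebra.
From mathcomp Require Import fraction mpoly ring zify.

(** With c_2 = 0 the equation reads A y2 + B = 0, where A = d y0 + c_1 y1 and B
    do not involve y2.  If c_1 <> 0 and A does not divide B, which follows from
    c_1^2 a_0 - c_1 b_0 d_0 + c_0 d_0^2 <> 0, the equation is irreducible, and
    solving for y2 = - B / A makes s = x1 / x0 and t = y1 / (x0^4 y0) free
    generators of the field of degree-0 fractions.

    For density, the shear y1 |-> y1 + g y2 takes the hyperplane c_2 = 0 to the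
    conic bundles whose form c_0 y1^2 + c_1 y1 y2 + c_2 y2^2 vanishes at
    (- g, 1), that is c_2 = g c_1 - g^2 c_0.  If c_1 <> 0, infinitely many c_2
    are of this form while the other 21 coordinates are fixed, so an equation
    of the closure vanishes whenever c_1 <> 0, hence everywhere. *)

Set Implicit Arguments.
Unset Strict Implicit.
Unset Printing Implicit Defensive.
Import GRing.Theory.
Local Open Scope ring_scope.

Local Notation tofrac := FracField.tofrac.
Local Notation "x %:F" := (tofrac x).

(** * Extending injective ring morphisms to fraction fields *)

Section FractionField.
Variable R : idomainType.

Lemma fraction_numden (z : {fraction R}) :
  let r := repr z in z = (\n_r)%:F / (\d_r)%:F.
Proof.
move=> r; have dn0 : (\d_r)%:F != 0 :> {fraction R}.
  by rewrite tofrac_eq0 denom_ratioP.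
apply: (mulIf dn0); rewrite divfK // -[z]reprK -/r.
unlock tofrac; rewrite -[LHS]FracField.pi_mul; apply/eqmodP.
rewrite /FracField.mulf /= FracField.equivfE.
by rewrite !numden_Ratio ?(oner_neq0, mul1r, mulr1, mulf_neq0, denom_ratioP) // mulrC.
Qed.

(** Injectivity of [f] keeps the images of denominators nonzero, so n / d can be sent to f n / f
    d. *)
Lemma fraction_lift (L : fieldType) (f : {rmorphism R -> L}) :
  (forall x, f x = 0 -> x = 0) ->
  exists j : {rmorphism {fraction R} -> L}, forall x, j x%:F = f x.
Proof.
move=> f_inj; pose g (z : {fraction R}) := f \n_(repr z) / f \d_(repr z).
have fn0 x : x != 0 -> f x != 0 by apply: contra_neq => /f_inj.
have dn0 (z : {fraction R}) : \d_(repr z) != 0 := denom_ratioP _.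
(* [g] is defined through chosen representatives. Its independence of that choice is what makes it
   additive and multiplicative. *)
have gE z n d : d != 0 -> z = n%:F / d%:F -> g z = f n / f d.
  move=> d0 zE; have := fraction_numden z => /= /esym; rewrite {3}zE => /eqP.
  rewrite eqr_div ?tofrac_eq0 // -!tofracM tofrac_eq => /eqP e.
  by apply/eqP; rewrite eqr_div ?fn0 // -!rmorphM e.
have gF x : g x%:F = f x.
  by rewrite (gE _ x 1) ?oner_eq0 ?rmorph1 ?divr1 ?tofrac1 ?divr1.
have zE (z : {fraction R}) : exists n d, d != 0 /\ z = n%:F / d%:F.
  by exists \n_(repr z), \d_(repr z); split=> //; apply: fraction_numden.
have gB : zmod_morphism g.
  move=> z1 z2; have [n1 [d1 [h1 e1]]] := zE z1.
  have [n2 [d2 [h2 e2]]] := zE z2.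
  rewrite (gE z1 n1 d1) // (gE z2 n2 d2) //.
  rewrite (gE _ (n1 * d2 - n2 * d1) (d1 * d2)) ?mulf_neq0 //.
    by rewrite rmorphB !rmorphM /= -[- (_ / _)]mulNr addf_div ?fn0 // mulNr.
  by rewrite e1 e2 rmorphB !rmorphM /= -[- (_ / _)]mulNr addf_div ?tofrac_eq0 // mulNr.
have gM : monoid_morphism g.
  split=> [|z1 z2]; first by rewrite -tofrac1 gF rmorph1.
  have [n1 [d1 [h1 e1]]] := zE z1; have [n2 [d2 [h2 e2]]] := zE z2.
  rewrite (gE z1 n1 d1) // (gE z2 n2 d2) //.
  rewrite (gE _ (n1 * n2) (d1 * d2)) ?mulf_neq0 //.
    by rewrite !rmorphM /= mulf_div.
  by rewrite e1 e2 !rmorphM /= mulf_div.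
pose g1 := GRing.isZmodMorphism.Build _ _ g gB.
pose g2 := GRing.isMonoidMorphism.Build _ _ g gM.
pose j : {rmorphism {fraction R} -> L} := HB.pack g g1 g2.
by exists j.
Qed.

End FractionField.

(** * Polynomial induction and substitutions modulo an ideal *)

Section Mpoly.
Variables (n : nat) (R : comNzRingType).

Lemma mpoly_ring_ind (P : {mpoly R[n]} -> Prop) :
  (forall c, P c%:MP) -> (forall i, P 'X_i) ->
  (forall p q, P p -> P q -> P (p + q)) ->
  (forall p q, P p -> P q -> P (p * q)) ->
  forall p, P p.
Proof.
move=> PC PX PD PM p; elim/mpolyind: p => [|c m p _ _ Pp]; first by rewrite -mpolyC0.
apply: PD => //; rewrite -mul_mpolyC; apply: (PM) => //.
rewrite mpolyXE_id; apply: (big_ind P) => // [|i _]; first by rewrite -mpolyC1.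
by elim: (m i) => [|e IH]; [rewrite expr0 -mpolyC1 | rewrite exprS; apply: (PM)].
Qed.

(** Congruence modulo A passes from the variables to sums and products. With p', q' the substituted
    polynomials, pq - p'q' = (p - p') q + p' (q - q'). *)
Lemma comp_mpoly_sub_ideal (A : {mpoly R[n]}) (s : n.-tuple {mpoly R[n]}) :
  (forall i, exists H, 'X_i - tnth s i = H * A) ->
  forall p, exists H, p - (p \mPo s) = H * A.
Proof.
move=> sA p; elim/mpoly_ring_ind: p => [c|i|p q [H1 e1] [H2 e2]|p q [H1 e1] [H2 e2]].
- by exists 0; rewrite comp_mpolyC subrr mul0r.
- by have [H e] := sA i; exists H; rewrite comp_mpolyXU -tnth_nth.
- by exists (H1 + H2); rewrite mulrDl -e1 -e2 rmorphD /= opprD addrACA.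
exists (H1 * q + (p \mPo s) * H2).
by rewrite mulrDl mulrAC -e1 -mulrA -e2 rmorphM /= mulrBl mulrBr addrA subrK.
Qed.

Lemma mpoly_rmorph_eq (S : comNzRingType) (f g : {rmorphism {mpoly R[n]} -> S}) :
  (forall c, f c%:MP = g c%:MP) -> (forall i, f 'X_i = g 'X_i) -> f =1 g.
Proof.
move=> fgC fgX p; elim/mpoly_ring_ind: p => [c|i|p q e1 e2|p q e1 e2] //.
- by rewrite !rmorphD /= e1 e2.
- by rewrite !rmorphM /= e1 e2.
Qed.

End Mpoly.

Lemma ord5_ind (P : 'I_5 -> Prop) :
  P ix0 -> P ix1 -> P iy0 -> P iy1 -> P iy2 -> forall i, P i.
Proof.
move=> P0 P1 P2 P3 P4 [[|[|[|[|[|//]]]]] h].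
- by rewrite (_ : Ordinal h = ix0) //; apply: val_inj.
- by rewrite (_ : Ordinal h = ix1) //; apply: val_inj.
- by rewrite (_ : Ordinal h = iy0) //; apply: val_inj.
- by rewrite (_ : Ordinal h = iy1) //; apply: val_inj.
- by rewrite (_ : Ordinal h = iy2) //; apply: val_inj.
Qed.

(** * The bigrading of the Cox ring *)

Section Bihomogeneous.
Variable k : fieldType.
Implicit Types (P Q : {mpoly k[5]}) (e f : int * int).

Lemma bidegD m1 m2 : bideg (m1 + m2)%MM = bideg m1 + bideg m2.
Proof. by rewrite /bideg !mnmDE; congr pair => /=; lia. Qed.

Lemma bihomogD e P Q : bihomog e P -> bihomog e Q -> bihomog e (P + Q).
Proof.
move=> hP hQ m /msuppD_le; rewrite mem_cat => /orP[]; [exact: hP|exact: hQ].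
Qed.

Lemma bihomogM e f P Q : bihomog e P -> bihomog f Q -> bihomog (e + f) (P * Q).
Proof.
move=> hP hQ m /msuppM_le /allpairsP[[m1 m2] /= [/hP <- /hQ <- ->]].
exact: bidegD.
Qed.

Lemma bihomogX m : bihomog (bideg m) ('X_[m] : {mpoly k[5]}).
Proof. by move=> m' /mem_msuppXP <-. Qed.

Lemma bihomogC (c : k) : bihomog 0 (c%:MP : {mpoly k[5]}).
Proof.
move=> m; rewrite msuppC; case: eqP => // _.
by rewrite inE => /eqP ->; rewrite /bideg !mnm0E.
Qed.

Lemma bihomogXn e P n : bihomog e P -> bihomog (e *+ n) (P ^+ n).
Proof.
move=> hP; elim: n => [|n IH]; first by rewrite expr0 -mpolyC1; apply: bihomogC.
by rewrite exprS mulrS; apply: bihomogM.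
Qed.

Lemma bideg_x0 : bideg U_(ix0)%MM = (1, 0). Proof. by rewrite /bideg !mnm1E. Qed.
Lemma bideg_x1 : bideg U_(ix1)%MM = (1, 0). Proof. by rewrite /bideg !mnm1E. Qed.
Lemma bideg_y0 : bideg U_(iy0)%MM = (-4%:Z, 1).
Proof. by rewrite /bideg !mnm1E. Qed.
Lemma bideg_y1 : bideg U_(iy1)%MM = (0, 1). Proof. by rewrite /bideg !mnm1E. Qed.
Lemma bideg_y2 : bideg U_(iy2)%MM = (0, 1). Proof. by rewrite /bideg !mnm1E. Qed.

End Bihomogeneous.

(** * Binary forms in x0, x1 *)

Section BinaryForms.
Variable k : fieldType.

Definition bin_form n (c : nat -> k) : {mpoly k[5]} :=
  \sum_(i < n.+1) c i *: (x0 ^+ (n - i) * x1 ^+ i).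

Lemma rmorph_bin_form (S : comNzRingType) (h : {rmorphism {mpoly k[5]} -> S}) n c :
  h (bin_form n c) =
  \sum_(i < n.+1) h (c i)%:MP * (h x0 ^+ (n - i) * h x1 ^+ i).
Proof.
rewrite rmorph_sum; apply: eq_bigr => i _.
by rewrite -mul_mpolyC !rmorphM /= !rmorphXn.
Qed.

Lemma meval_bin_form (w : 'I_5 -> k) n c :
  w ix0 = 1 -> w ix1 = 0 -> (bin_form n c).@[w] = c 0%N.
Proof.
move=> w0 w1; rewrite (rmorph_bin_form (meval w)) /= big_ord_recl /= !mevalXU w0 w1.
rewrite big1 => [|i _]; last by rewrite expr0n /= !mulr0.
by rewrite mevalC expr1n expr0 !mulr1 addr0.
Qed.

End BinaryForms.

(** * The ideal of the surface as the kernel of solving for y2 *)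

Section Surface.
Variables (k : fieldType) (a b d : nat -> k) (c0 c1 : k).
Hypothesis c1_neq0 : c1 != 0.
Hypothesis disc_neq0 : c1 ^+ 2 * a 0%N - c1 * b 0%N * d 0%N + c0 * d 0%N ^+ 2 != 0.

Local Notation Phi := {mpoly k[5]}.
Local Notation L := {fraction Phi}.
Local Notation D := (bin_form 4 d).

Definition lin_coef : Phi := D * y0 + c1%:MP * y1.
Definition const_coef : Phi :=
  bin_form 8 a * y0 ^+ 2 + bin_form 4 b * (y0 * y1) + c0%:MP * y1 ^+ 2.
Local Notation A := lin_coef.
Local Notation B := const_coef.
Local Notation F := (A * y2 + B).

Lemma rmorph_lin_coef (S : comNzRingType) (h : {rmorphism Phi -> S}) :
  h A = h D * h y0 + h c1%:MP * h y1.
Proof. by rewrite rmorphD !rmorphM. Qed.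

Lemma rmorph_const_coef (S : comNzRingType) (h : {rmorphism Phi -> S}) :
  h B = h (bin_form 8 a) * h y0 ^+ 2 + h (bin_form 4 b) * (h y0 * h y1)
        + h c0%:MP * h y1 ^+ 2.
Proof. by rewrite !(rmorphD, rmorphXn, rmorphM). Qed.

Lemma lin_coef_neq0 : A != 0.
Proof.
pose w (i : 'I_5) : k := (i == iy1)%:R.
apply: contra_neq c1_neq0 => A0; have: A.@[w] = 0 by rewrite A0 meval0.
rewrite (rmorph_lin_coef (meval w)) /= mevalC !mevalXU.
by rewrite /w /= mulr0 add0r mulr1.
Qed.

(* Reduction modulo A. *)
Definition mod_lin : 5.-tuple Phi :=
  [tuple x0; x1; y0; (- c1^-1)%:MP * (D * y0); y2].

Lemma mod_lin_x0 : x0 \mPo mod_lin = x0. Proof. by rewrite comp_mpolyXU. Qed.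
Lemma mod_lin_x1 : x1 \mPo mod_lin = x1. Proof. by rewrite comp_mpolyXU. Qed.
Lemma mod_lin_y0 : y0 \mPo mod_lin = y0. Proof. by rewrite comp_mpolyXU. Qed.
Lemma mod_lin_y1 : y1 \mPo mod_lin = (- c1^-1)%:MP * (D * y0).
Proof. by rewrite comp_mpolyXU. Qed.

Lemma mod_lin_bin_form n c : (bin_form n c) \mPo mod_lin = bin_form n c.
Proof.
rewrite (rmorph_bin_form (comp_mpoly mod_lin)) /= mod_lin_x0 mod_lin_x1.
by apply: eq_bigr => i _; rewrite comp_mpolyC mul_mpolyC.
Qed.

Lemma mod_lin_A : A \mPo mod_lin = 0.
Proof.
rewrite (rmorph_lin_coef (comp_mpoly mod_lin)) /= mod_lin_bin_form mod_lin_y0 mod_lin_y1.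
by rewrite comp_mpolyC mulrA -mpolyCM mulrN divff // mpolyCN mpolyC1 mulN1r subrr.
Qed.

(** Modulo A only B survives, with y1 = - D y0 / c1. At x0 = y0 = 1 and x1 = 0 its value is the
    expression in [disc_neq0] divided by c1^2. *)
Lemma mod_lin_F_neq0 : F \mPo mod_lin != 0.
Proof.
pose w (i : 'I_5) : k := ((i == ix0) || (i == iy0))%:R.
rewrite rmorphD rmorphM /= mod_lin_A mul0r add0r.
apply: contra_neq disc_neq0 => B0.
have: (B \mPo mod_lin).@[w] = 0 by rewrite B0 meval0.
rewrite (rmorph_const_coef (comp_mpoly mod_lin)) /=.
rewrite !mod_lin_bin_form mod_lin_y0 mod_lin_y1.
rewrite comp_mpolyC !(rmorphD (meval w), rmorphXn (meval w), rmorphM (meval w)) /=.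
rewrite !meval_bin_form // !mevalC !mevalXU /w /= => e.
have -> : c1 ^+ 2 * a 0%N - c1 * b 0%N * d 0%N + c0 * d 0%N ^+ 2 =
  c1 ^+ 2 * (a 0%N * 1 ^+ 2 + b 0%N * (1 * (- c1^-1 * (d 0%N * 1))) +
   c0 * (- c1^-1 * (d 0%N * 1)) ^+ 2) by field.
by rewrite e mulr0.
Qed.

(** The only variable that [mod_lin] moves is y1, and it moves it by c1^-1 A. *)
Lemma sub_mod_lin P : exists H, P - (P \mPo mod_lin) = H * A.
Proof.
apply: comp_mpoly_sub_ideal; elim/ord5_ind;
  do 1?[by exists 0; rewrite mul0r subrr].
exists (c1^-1)%:MP; rewrite /tnth /= mpolyCN mulNr opprK /lin_coef mulrDr addrC.
by congr (_ + _); rewrite mulrA -mpolyCM mulVf // mpolyC1 mul1r.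
Qed.

(** Reducing the equation modulo A kills its left side. As F stays nonzero, H reduces to 0, hence is
    a multiple of A, and A cancels. *)
Lemma lin_coef_coprime G H : A * G = H * F -> exists H', G = H' * F.
Proof.
move=> e; have [H' eH] := sub_mod_lin H.
have H0 : H \mPo mod_lin = 0.
  move/(congr1 (comp_mpoly mod_lin)): e; rewrite !rmorphM /= mod_lin_A mul0r.
  by move/esym/eqP; rewrite mulf_eq0 (negPf mod_lin_F_neq0) orbF => /eqP.
exists H'; apply: (mulfI lin_coef_neq0); rewrite e -[H]subr0 -H0 eH.
by rewrite mulrAC mulrC mulrA.
Qed.

Lemma lin_coef_exp_coprime n G H : A ^+ n * G = H * F -> exists H', G = H' * F.
Proof.
elim: n H => [|n IH] H; first by rewrite expr0 mul1r => ->; exists H.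
by rewrite exprS -mulrA => /lin_coef_coprime[H' /IH].
Qed.

(** The image of y2 is the root of F, linear in y2. The target field is larger than the fraction
    field of the quotient by F, which [is_function_field] allows. *)
Definition surface_gen (i : 'I_5) : L :=
  if i == iy2 then - (B%:F / A%:F) else ('X_i)%:F.

Definition surface_map : {rmorphism Phi -> L} :=
  mmap (@FracField.tofrac Phi \o @mpolyC 5 k) surface_gen.
Local Notation q := surface_map.

Lemma surface_mapC c : q c%:MP = (c%:MP)%:F. Proof. exact: mmapC. Qed.
Lemma surface_mapX i : q 'X_i = surface_gen i.
Proof. by rewrite /q /= mmapX mmap1U. Qed.
Lemma surface_map_x0 : q x0 = x0%:F. Proof. by rewrite surface_mapX. Qed.
Lemma surface_map_x1 : q x1 = x1%:F. Proof. by rewrite surface_mapX. Qed.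
Lemma surface_map_y0 : q y0 = y0%:F. Proof. by rewrite surface_mapX. Qed.
Lemma surface_map_y1 : q y1 = y1%:F. Proof. by rewrite surface_mapX. Qed.
Lemma surface_map_y2 : q y2 = - (B%:F / A%:F). Proof. by rewrite surface_mapX. Qed.

Lemma surface_map_bin_form n c : q (bin_form n c) = (bin_form n c)%:F.
Proof.
rewrite (rmorph_bin_form surface_map) (rmorph_bin_form (@FracField.tofrac Phi)).
rewrite surface_map_x0 surface_map_x1.
by apply: eq_bigr => i _; rewrite surface_mapC.
Qed.

Lemma surface_map_A : q A = A%:F.
Proof.
rewrite (rmorph_lin_coef surface_map) (rmorph_lin_coef (@FracField.tofrac Phi)).
by rewrite surface_map_bin_form surface_mapC surface_map_y0 surface_map_y1.
Qed.

Lemma surface_map_B : q B = B%:F.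
Proof.
rewrite (rmorph_const_coef surface_map) (rmorph_const_coef (@FracField.tofrac Phi)).
by rewrite !surface_map_bin_form surface_mapC surface_map_y0 surface_map_y1.
Qed.

Lemma lin_coefF_neq0 : A%:F != 0 :> L.
Proof. by rewrite tofrac_eq0 lin_coef_neq0. Qed.

Lemma surface_map_F : q F = 0.
Proof.
rewrite rmorphD rmorphM /= surface_map_A surface_map_B surface_map_y2.
by rewrite mulrN mulrC divfK ?lin_coefF_neq0 // addNr.
Qed.

(** Clears the powers of A in the denominator of [q P]. The numerator P0 is also A^n P modulo F, so
    when [q P] vanishes, F divides A^n P. *)
Lemma surface_map_num P : exists n P0 H,
  A%:F ^+ n * q P = P0%:F /\ A ^+ n * P = P0 + H * F.
Proof.
elim/mpoly_ring_ind: P => [c|i|P1 P2|P1 P2].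
- by exists 0%N, c%:MP, 0; rewrite !expr0 !mul1r mul0r addr0 surface_mapC.
- rewrite surface_mapX /surface_gen; case: eqP => [->|_]; last first.
    by exists 0%N, 'X_i, 0; rewrite !expr0 !mul1r mul0r addr0.
  (* For y2 the relation is A y2 = - B + F. *)
  exists 1%N, (- B), 1; rewrite !expr1 rmorphN mulrN mulrC divfK ?lin_coefF_neq0 //.
  by rewrite mul1r addrCA addNr addr0.
- move=> [n1 [Q1 [H1 [e1 f1]]]] [n2 [Q2 [H2 [e2 f2]]]].
  have distr (T : comNzRingType) (x u v : T) :
    x ^+ (n1 + n2) * (u + v) = x ^+ n2 * (x ^+ n1 * u) + x ^+ n1 * (x ^+ n2 * v).
    by rewrite exprD; ring.
  have factor (T : comNzRingType) (x1 x2 u1 u2 v1 v2 g : T) :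
    x2 * (u1 + v1 * g) + x1 * (u2 + v2 * g)
    = x2 * u1 + x1 * u2 + (x2 * v1 + x1 * v2) * g by ring.
  exists (n1 + n2)%N, (A ^+ n2 * Q1 + A ^+ n1 * Q2), (A ^+ n2 * H1 + A ^+ n1 * H2).
  split; last by rewrite distr f1 f2 factor.
  rewrite (rmorphD q) distr e1 e2 [RHS]tofracD; congr (_ + _).
    by rewrite [RHS]tofracM tofracXn.
  by rewrite [RHS]tofracM tofracXn.
move=> [n1 [Q1 [H1 [e1 f1]]]] [n2 [Q2 [H2 [e2 f2]]]].
exists (n1 + n2)%N, (Q1 * Q2), (H1 * (A ^+ n2 * P2) + Q1 * H2).
have distr (T : comNzRingType) (x u v : T) :
  x ^+ (n1 + n2) * (u * v) = (x ^+ n1 * u) * (x ^+ n2 * v) by rewrite exprD mulrACA.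
have factor (T : comNzRingType) (u1 u2 v1 v2 g : T) :
  (u1 + v1 * g) * (u2 + v2 * g) = u1 * u2 + (v1 * (u2 + v2 * g) + u1 * v2) * g by ring.
split; first by rewrite (rmorphM q) distr e1 e2 [RHS]tofracM.
by rewrite distr f1 f2 factor.
Qed.

Lemma surface_map_eq0 P : q P = 0 <-> exists H, P = H * F.
Proof.
split=> [P0|[H ->]]; last by rewrite rmorphM /= surface_map_F mulr0.
have [n [Q [H []]]] := surface_map_num P.
rewrite P0 mulr0 => /esym/eqP; rewrite tofrac_eq0 => /eqP ->; rewrite add0r.
exact: lin_coef_exp_coprime.
Qed.

End Surface.

(** * Fractions of bidegree 0 as rational functions of two coordinates *)

Section PlaneCoordinates.
Variables (k L : fieldType) (q : {rmorphism {mpoly k[5]} -> L}).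
Hypotheses (qx0 : q x0 != 0) (qy0 : q y0 != 0).

(** Both quotients have bidegree 0, since x0^4 y0 has the bidegree (0, 1) of y1. *)
Definition plane_gen (i : 'I_2) : L :=
  if i == 0 then q x1 / q x0 else q y1 / (q x0 ^+ 4 * q y0).

Definition plane_map : {rmorphism {mpoly k[2]} -> L} :=
  mmap (q \o @mpolyC 5 k) plane_gen.
Local Notation f := plane_map.

Lemma plane_mapC c : f c%:MP = q c%:MP. Proof. exact: mmapC. Qed.
Lemma plane_mapX i : f 'X_i = plane_gen i.
Proof. by rewrite /f /= mmapX mmap1U. Qed.

(* y2 does not occur in the homogenizations below, so its image is arbitrary. *)
Definition affine_chart : 5.-tuple {mpoly k[2]} := [tuple 1; 'X_0; 1; 'X_1; 0].

Lemma affine_chart_unit : (x0 ^+ 4 * y0) \mPo affine_chart = 1.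
Proof. by rewrite rmorphM rmorphXn /= !comp_mpolyXU expr1n mulr1. Qed.

Let unit_neq0 : q x0 ^+ 4 * q y0 != 0.
Proof. by rewrite mulf_neq0 ?expf_neq0. Qed.

Lemma bihomog_unit n : bihomog (0, n%:Z) ((x0 ^+ 4 * y0) ^+ n : {mpoly k[5]}).
Proof.
have -> : (0, n%:Z) = ((1, 0) *+ 4 + (-4%:Z, 1)) *+ n :> (int * int)%type.
  by rewrite pairMnE /= mul0rn; congr pair; lia.
apply/bihomogXn/bihomogM; [apply: bihomogXn|].
  by rewrite -bideg_x0; apply: bihomogX.
by rewrite -bideg_y0; apply: bihomogX.
Qed.

(** Powers of x0^4 y0 clear all denominators. The bidegree of h serves to write elements of k(s, t)
    as bihomogeneous fractions; recovering p from h on the chart x0 = y0 = 1 serves injectivity. *)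
Lemma plane_map_homogenize p : exists n h,
  [/\ bihomog (0, n%:Z) h, (q x0 ^+ 4 * q y0) ^+ n * f p = q h
    & h \mPo affine_chart = p].
Proof.
elim/mpoly_ring_ind: p => [c|i|p1 p2|p1 p2].
- exists 0%N, c%:MP; rewrite expr0 mul1r plane_mapC comp_mpolyC; split=> //.
  exact: bihomogC.
- rewrite plane_mapX /plane_gen; case: eqP => [->|/eqP i0].
    exists 1%N, (x1 * x0 ^+ 3 * y0); split.
    + rewrite (_ : (0, 1%:Z) = (1, 0) + (1, 0) *+ 3 + (-4%:Z, 1)) //.
      apply: bihomogM; [apply: bihomogM; [|apply: bihomogXn]|].
      * by rewrite -bideg_x1; apply: bihomogX.
      * by rewrite -bideg_x0; apply: bihomogX.
      * by rewrite -bideg_y0; apply: bihomogX.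
    + by rewrite !(rmorphXn q, rmorphM q) expr1; field.
    by rewrite !(rmorphXn, rmorphM) /= !comp_mpolyXU expr1n !mulr1.
  exists 1%N, y1; split; first by rewrite -bideg_y1; apply: bihomogX.
    by rewrite expr1 mulrC divfK.
  rewrite comp_mpolyXU /=; congr ('X_ _); apply/val_inj.
  by case: i i0 => [[|[|]]].
- move=> [n1 [h1 [b1 e1 g1]]] [n2 [h2 [b2 e2 g2]]].
  (* The extra powers bring both summands to bidegree (0, n1 + n2). *)
  exists (n1 + n2)%N, (h1 * (x0 ^+ 4 * y0) ^+ n2 + h2 * (x0 ^+ 4 * y0) ^+ n1); split.
  + apply: bihomogD.
      rewrite (_ : (0, _) = (0, n1%:Z) + (0, n2%:Z)) //.
      by apply: (bihomogM b1); apply: bihomog_unit.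
    rewrite (_ : (0, _) = (0, n2%:Z) + (0, n1%:Z)); last by congr pair => /=; lia.
    by apply: (bihomogM b2); apply: bihomog_unit.
  + by rewrite (rmorphD f) !(rmorphD q, rmorphXn q, rmorphM q) -e1 -e2 exprD; ring.
  by rewrite rmorphD !rmorphM !rmorphXn /= affine_chart_unit !expr1n !mulr1 /= g1 g2.
move=> [n1 [h1 [b1 e1 g1]]] [n2 [h2 [b2 e2 g2]]].
exists (n1 + n2)%N, (h1 * h2); split.
- rewrite (_ : (0, _) = (0, n1%:Z) + (0, n2%:Z)) //.
  exact: bihomogM.
- by rewrite (rmorphM f) (rmorphM q) -e1 -e2 exprD mulrACA.
by rewrite rmorphM /= g1 g2.
Qed.

Lemma plane_map_inj : (forall P, q P = 0 -> P = 0) -> forall p, f p = 0 -> p = 0.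
Proof.
move=> q_inj p p0; have [n [h [_ e <-]]] := plane_map_homogenize p.
by move: e; rewrite p0 mulr0 => /esym /q_inj ->; rewrite rmorph0.
Qed.

Variable j : {rmorphism {fraction {mpoly k[2]}} -> L}.
Hypothesis jE : forall p, j p%:F = f p.

(** This is the image of the Laurent monomial in x0, y0 of bidegree e. The term 4 e.2 compensates
    for the degree -4 of y0. *)
Definition weight (e : int * int) : L := q x0 ^ (e.1 + 4%:Z * e.2) * q y0 ^ e.2.

Lemma weightD e e' : weight (e + e') = weight e * weight e'.
Proof.
rewrite /weight mulrACA -!expfzDr //; congr (_ ^ _ * _) => /=; lia.
Qed.

Lemma weight0 : weight 0 = 1. Proof. by rewrite /weight !expr0z mulr1. Qed.

Lemma weight_neq0 e : weight e != 0.
Proof. by rewrite mulf_neq0 ?expfz_neq0. Qed.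

(** A substitute for a grading on L: an element of bidegree e is one that becomes a rational
    function of s, t once divided by the reference monomial. *)
Definition has_weight (e : int * int) (z : L) := exists u, z = weight e * j u.

Lemma has_weightD e z z' :
  has_weight e z -> has_weight e z' -> has_weight e (z + z').
Proof. by move=> [u ->] [u' ->]; exists (u + u'); rewrite rmorphD mulrDr. Qed.

Lemma has_weight_sum I r (P : pred I) e (z : I -> L) :
  (forall i, P i -> has_weight e (z i)) ->
  has_weight e (\sum_(i <- r | P i) z i).
Proof.
move=> hz; apply: big_ind => //; last exact: has_weightD.
by exists 0; rewrite rmorph0 mulr0.
Qed.

Lemma has_weightM e e' z z' :
  has_weight e z -> has_weight e' z' -> has_weight (e + e') (z * z').
Proof.
by move=> [u ->] [u' ->]; exists (u * u'); rewrite rmorphM weightD mulrACA.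
Qed.

Lemma has_weightXn e z n : has_weight e z -> has_weight (e *+ n) (z ^+ n).
Proof.
move=> hz; elim: n => [|n IH]; last by rewrite exprS mulrS; apply: has_weightM.
by exists 1; rewrite rmorph1 expr0 weight0 mulr1.
Qed.

Lemma has_weightV e z : has_weight e z -> has_weight (- e) z^-1.
Proof.
move=> [u ->]; exists u^-1; rewrite invfM fmorphV; congr (_ * _).
by apply: (mulfI (weight_neq0 e)); rewrite -weightD subrr weight0 divff ?weight_neq0.
Qed.

Lemma has_weightN e z : has_weight e z -> has_weight e (- z).
Proof. by move=> [u ->]; exists (- u); rewrite rmorphN mulrN. Qed.

Lemma has_weightC c : has_weight 0 (q c%:MP).
Proof. by exists (c%:MP)%:F; rewrite weight0 mul1r jE plane_mapC. Qed.

Lemma has_weight_x0 : has_weight (1, 0) (q x0).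
Proof. by exists 1; rewrite rmorph1 /weight mulr1 mulr1. Qed.

Lemma has_weight_x1 : has_weight (1, 0) (q x1).
Proof.
exists ('X_0)%:F; rewrite jE plane_mapX /plane_gen eqxx /weight mulr1.
by rewrite mulrC divfK.
Qed.

Lemma has_weight_y0 : has_weight (-4%:Z, 1) (q y0).
Proof. by exists 1; rewrite rmorph1 /weight /= mul1r mulr1. Qed.

Lemma has_weight_y1 : has_weight (0, 1) (q y1).
Proof.
exists ('X_1)%:F; rewrite jE plane_mapX /plane_gen /= /weight /=.
by rewrite mulrC divfK.
Qed.

Lemma has_weight_bin_form n c : has_weight (n%:Z, 0) (q (bin_form n c)).
Proof.
rewrite rmorph_bin_form; apply: has_weight_sum => i _.
have -> : (n%:Z, 0) = 0 + ((1, 0) *+ (n - i) + (1, 0) *+ i) :> (int * int)%type.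
  by rewrite !pairMnE /= !mul0rn; congr pair => /=; have := ltn_ord i; lia.
apply: has_weightM; first exact: has_weightC.
by apply: has_weightM; apply: has_weightXn; [exact: has_weight_x0|exact: has_weight_x1].
Qed.

Hypothesis has_weight_y2 : has_weight (0, 1) (q y2).

(** Weights add under products, so the variables suffice. The weight of y2 is a hypothesis because
    it has to come from the equation of the surface. *)
Lemma bihomog_has_weight e P : bihomog e P -> has_weight e (q P).
Proof.
move=> hP; rewrite [P]mpolyE rmorph_sum big_seq; apply: has_weight_sum => m /hP <-.
rewrite -mul_mpolyC rmorphM -[bideg m]add0r; apply: has_weightM.
  exact: has_weightC.
rewrite mpolyXE_id rmorph_prod /=.
have -> : bideg m = \sum_(i < 5) bideg U_(i)%MM *+ m i.
  have bideg0 : bideg 0%MM = 0 by rewrite /bideg !mnm0E.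
  rewrite [m in LHS]multinomUE_id (big_morph bideg bidegD bideg0).
  apply: eq_bigr => i _; elim: (m i) => [|n IH]; first by rewrite mulm0n.
  by rewrite mulmS bidegD IH mulrS.
apply: (big_ind2 has_weight) => [|*|i _].
- by exists 1; rewrite rmorph1 weight0 mulr1.
- exact: has_weightM.
rewrite rmorphXn; apply: has_weightXn.
elim/ord5_ind: i; rewrite ?bideg_x0 ?bideg_x1 ?bideg_y0 ?bideg_y1 ?bideg_y2.
- exact: has_weight_x0.
- exact: has_weight_x1.
- exact: has_weight_y0.
- exact: has_weight_y1.
exact: has_weight_y2.
Qed.

(** In a quotient of equal bidegrees the reference monomials cancel. Conversely, the numerator and
    the denominator of u are homogenized separately. *)
Lemma degree0_fractions z :
  (exists u, z = j u) <->
  (exists e P R, [/\ bihomog e P, bihomog e R, q R != 0 & z = q P / q R]).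
Proof.
split=> [[u ->]|[e [P [R [hP hR R0 ->]]]]]; last first.
  have [u eu] := bihomog_has_weight hP; have [v ev] := bihomog_has_weight hR.
  exists (u / v); rewrite eu ev rmorphM fmorphV -mulf_div divff ?mul1r //.
  exact: weight_neq0.
set r := repr u; pose n := \n_r; pose m := \d_r.
have [N1 [h1 [b1 e1 _]]] := plane_map_homogenize n.
have [N2 [h2 [b2 e2 _]]] := plane_map_homogenize m.
have m0 : f m != 0 by rewrite -jE fmorph_eq0 tofrac_eq0 denom_ratioP.
(* Cross-multiplying by the clearing powers equalizes the bidegrees. *)
exists (0, N1%:Z + N2%:Z), (h1 * (x0 ^+ 4 * y0) ^+ N2), (h2 * (x0 ^+ 4 * y0) ^+ N1).
split.
- rewrite (_ : (0, _) = (0, N1%:Z) + (0, N2%:Z)) //.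
  by apply: (bihomogM b1); apply: bihomog_unit.
- rewrite (_ : (0, _) = (0, N2%:Z) + (0, N1%:Z)); last by congr pair => /=; lia.
  by apply: (bihomogM b2); apply: bihomog_unit.
- by rewrite !(rmorphXn q, rmorphM q) -e2 !mulf_neq0 ?expf_neq0.
rewrite (fraction_numden u) rmorphM fmorphV !jE -/r -/n -/m.
rewrite !(rmorphXn q, rmorphM q) -e1 -e2.
by field; rewrite m0 !expf_neq0.
Qed.

End PlaneCoordinates.

(** * The function field of the surface is k(s, t) *)

Section Rationality.
Variables (k : fieldType) (a b d : nat -> k) (c0 c1 : k).
Hypothesis c1_neq0 : c1 != 0.
Hypothesis disc_neq0 : c1 ^+ 2 * a 0%N - c1 * b 0%N * d 0%N + c0 * d 0%N ^+ 2 != 0.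

Local Notation Phi := {mpoly k[5]}.
Local Notation A := (lin_coef d c1).
Local Notation B := (const_coef a b c0).
Local Notation q := (surface_map a b d c0 c1).

Lemma mpolyXF_neq0 (i : 'I_5) : ('X_i : Phi)%:F != 0.
Proof. by rewrite tofrac_eq0 -msupp_eq0 msuppX. Qed.

(** The coordinates s, t avoid y2, the only variable on which [q] and [tofrac] differ. Thus
    injectivity can be taken from [tofrac], although [q] kills F. *)
Lemma plane_map_surface p : plane_map q p = plane_map (@FracField.tofrac Phi) p.
Proof.
apply: mpoly_rmorph_eq => [c|i]; first by rewrite !plane_mapC surface_mapC.
rewrite !plane_mapX /plane_gen.
by rewrite surface_map_x0 surface_map_x1 surface_map_y0 surface_map_y1.
Qed.

Lemma surface_function_field :
  @is_function_field k (A * y2 + B) {fraction {mpoly k[2]}}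
    (fun c => (c%:MP : {mpoly k[2]})%:F).
Proof.
pose f := plane_map (@FracField.tofrac Phi).
have qx0 : q x0 != 0 by rewrite surface_map_x0 mpolyXF_neq0.
have qy0 : q y0 != 0 by rewrite surface_map_y0 mpolyXF_neq0.
have f_inj p : f p = 0 -> p = 0.
  apply: plane_map_inj; rewrite ?mpolyXF_neq0 // => P /eqP.
  by rewrite tofrac_eq0 => /eqP.
have [j jf] := fraction_lift f_inj.
have jq p : j p%:F = plane_map q p by rewrite jf plane_map_surface.
exists {fraction Phi}, q, j; split=> [P|c|z].
- exact: surface_map_eq0.
- by rewrite jf /f plane_mapC surface_mapC.
(* It remains to give y2 the weight (0, 1). Its image is - B / A, where A has weight (0, 1) and B
   has weight (0, 2). *)
apply: (degree0_fractions qx0 qy0 jq).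
have wA : has_weight q j (0, 1) (q A).
  rewrite rmorph_lin_coef; apply: has_weightD.
    rewrite (_ : (0, 1) = (4%:Z, 0) + (-4%:Z, 1)) //.
    apply: (has_weightM qx0 qy0); first exact: (has_weight_bin_form qx0 qy0 jq).
    exact: has_weight_y0.
  rewrite -[(0, 1)]add0r; apply: (has_weightM qx0 qy0); first exact: (has_weightC jq).
  exact: (has_weight_y1 qx0 qy0 jq).
have wB : has_weight q j (0, 2%:Z) (q B).
  have wy0 := has_weight_y0 q j; have wy1 := has_weight_y1 qx0 qy0 jq.
  rewrite rmorph_const_coef; apply: has_weightD; first apply: has_weightD.
  - rewrite (_ : (0, 2%:Z) = (8%:Z, 0) + (-4%:Z, 1) *+ 2) //.
    apply: (has_weightM qx0 qy0); first exact: (has_weight_bin_form qx0 qy0 jq).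
    exact: (has_weightXn qx0 qy0).
  - rewrite (_ : (0, 2%:Z) = (4%:Z, 0) + ((-4%:Z, 1) + (0, 1))) //.
    apply: (has_weightM qx0 qy0); first exact: (has_weight_bin_form qx0 qy0 jq).
    exact: (has_weightM qx0 qy0).
  rewrite (_ : (0, 2%:Z) = 0 + (0, 1) *+ 2) //.
  apply: (has_weightM qx0 qy0); first exact: (has_weightC jq).
  exact: (has_weightXn qx0 qy0).
rewrite surface_map_y2 -(@surface_map_A k a b d c0 c1) -(@surface_map_B k a b d c0 c1).
apply: has_weightN; rewrite (_ : (0, 1) = (0, 2%:Z) - (0, 1)) //.
apply: (has_weightM qx0 qy0); [exact: wB|exact: (has_weightV qx0 qy0)].
Qed.

End Rationality.

Lemma conic_bundle_rational (k : fieldType) (v : 'rV[k]_22) :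
  coef_c v 2 = 0 -> coef_c v 1 != 0 ->
  coef_c v 1 ^+ 2 * coef_a v 0 - coef_c v 1 * coef_b v 0 * coef_d v 0
    + coef_c v 0 * coef_d v 0 ^+ 2 != 0 ->
  rational_surface (conic_bundle v).
Proof.
move=> v2 v1 disc; rewrite /rational_surface.
suff -> : conic_bundle v = lin_coef (coef_d v) (coef_c v 1) * y2
    + const_coef (coef_a v) (coef_b v) (coef_c v 0).
  exact: surface_function_field.
rewrite /conic_bundle v2 scale0r addr0 -!mul_mpolyC.
have regroup (T : comNzRingType) (pa pb pd p0 p1 t0 t1 t2 : T) :
  pa * t0 ^+ 2 + pb * (t0 * t1) + pd * (t0 * t2) + p0 * t1 ^+ 2 + p1 * (t1 * t2)
  = (pd * t0 + p1 * t1) * t2 + (pa * t0 ^+ 2 + pb * (t0 * t1) + p0 * t1 ^+ 2).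
  by ring.
exact: regroup.
Qed.

(** * Density of the image of chi *)

Section Density.
Variable k : fieldType.

(** Restriction to a line turns the vanishing of G into a question on roots in one variable. *)
Lemma meval_line n (G : {mpoly k[n]}) (u w : 'I_n -> k) :
  exists p : {poly k}, forall t, p.[t] = G.@[fun i => u i + t * w i].
Proof.
elim/mpoly_ring_ind: G => [c|i|G1 G2 [p1 e1] [p2 e2]|G1 G2 [p1 e1] [p2 e2]].
- by exists c%:P => t; rewrite hornerC mevalC.
- exists ((u i)%:P + (w i) *: 'X) => t.
  by rewrite mevalXU hornerD hornerC hornerZ hornerX mulrC.
- by exists (p1 + p2) => t; rewrite hornerD mevalD e1 e2.
by exists (p1 * p2) => t; rewrite hornerM mevalM e1 e2.
Qed.

Hypothesis k_infinite : infinite_field k.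

Lemma cofinite_roots_eq0 (s : seq k) (p : {poly k}) :
  (forall t, t \notin s -> p.[t] = 0) -> p = 0.
Proof.
(* [size p] distinct roots are one more than the degree of a nonzero p allows; each is picked
   outside s and the earlier ones. *)
move=> ps; have [rs [uniq_rs root_rs size_rs]] :
    exists rs, [/\ uniq rs, all (root p) rs & size rs = size p].
  elim: (size p) => [|n [rs [h1 h2 h3]]]; first by exists [::].
  have [x] := k_infinite (s ++ rs); rewrite mem_cat negb_or => /andP[xs xrs].
  by exists (x :: rs); rewrite /= xrs h1 h2 h3 rootE ps ?eqxx.
apply: contraTeq (leqnn (size p)) => p0.
by rewrite -ltnNge -{1}size_rs max_poly_roots.
Qed.

Lemma bin_form_eq n (c c' : nat -> k) :
  (forall i, (i <= n)%N -> c i = c' i) -> bin_form n c = bin_form n c'.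
Proof. by move=> e; apply: eq_bigr => i _; rewrite e // -ltnS. Qed.

Definition shear_mx (g : k) : 'M[k]_2 :=
  \matrix_(i, j) (if i == j then 1 else if i == 0 then g else 0).

Lemma shear_mx_unit g : shear_mx g \in unitmx.
Proof.
(* The matrix is upper triangular and [det_trig] is about lower triangular ones, hence the
   transpose. *)
rewrite unitmxE -det_tr det_trig ?big1 ?unitr1 // => [i _|]; first by rewrite !mxE eqxx.
by apply/is_trig_mxP => i j; rewrite !mxE; case: i j => [[|[|//]] ?] [[|[|//]] ?].
Qed.

Definition shear (g : k) : autT400 k :=
  AutT400 0 (unitmx1 k 2) (oner_neq0 k) (shear_mx_unit g).

(* Entries 14 to 18 are the d_i, and entries 20 and 21 are c_1 and c_2. *)
Definition unshear (g : k) (w : 'rV[k]_22) : 'rV[k]_22 :=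
  \row_i (if i == 21%N :> nat then 0
          else if i == 20%N :> nat then coef_c w 1 - 2%:R * g * coef_c w 0
          else if (14 <= i < 19)%N then w 0 i - g * w 0 (inord (i - 5))
          else w 0 i).

(** Under y1 |-> y1 + g y2, the y0 y1 term adds g b to d, and c_0 y1^2 adds 2 g c_0 to c_1;
    [unshear] subtracts both beforehand. The y2^2 coefficient produced is g^2 c_0 + g (c_1 - 2 g
    c_0), the required c_2. *)
Lemma conic_bundle_shear g w :
  coef_c w 2 = g * coef_c w 1 - g ^+ 2 * coef_c w 0 ->
  conic_bundle w = aut_pullback (shear g) (conic_bundle (unshear g w)).
Proof.
move=> w2; have ax0 : aut_x (shear g) 0 = x0.
  by rewrite /aut_x !mxE /= scale1r scale0r addr0.
have ax1 : aut_x (shear g) 1 = x1 by rewrite /aut_x !mxE /= scale1r scale0r add0r.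
have ay0 : aut_y (shear g) 0 = y1 + g%:MP * y2.
  rewrite /aut_y !mxE /= big1 ?addr0 => [|i _]; last by rewrite mxE scale0r.
  by rewrite scale1r mul_mpolyC.
have ay1 : aut_y (shear g) 1 = y2.
  rewrite /aut_y !mxE /= big1 ?addr0 => [|i _]; last by rewrite mxE scale0r.
  by rewrite scale1r scale0r add0r.
rewrite /aut_pullback ax0 ax1 ay0 ay1 scale1r; set s := [tuple _; _; _; _; _].
have sx0 : x0 \mPo s = x0 by rewrite comp_mpolyXU.
have sx1 : x1 \mPo s = x1 by rewrite comp_mpolyXU.
have sy0 : y0 \mPo s = y0 by rewrite comp_mpolyXU.
have sy1 : y1 \mPo s = y1 + g%:MP * y2 by rewrite comp_mpolyXU.
have sy2 : y2 \mPo s = y2 by rewrite comp_mpolyXU.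
have sbin n c : bin_form n c \mPo s = bin_form n c.
  rewrite (rmorph_bin_form (comp_mpoly s)) /= sx0 sx1.
  by apply: eq_bigr => i _; rewrite comp_mpolyC mul_mpolyC.
have va : bin_form 8 (coef_a (unshear g w)) = bin_form 8 (coef_a w).
  apply: bin_form_eq => i hi; rewrite /coef_a mxE inordK; last by lia.
  by do 3?[case: ifP; first by lia].
have vb : bin_form 4 (coef_b (unshear g w)) = bin_form 4 (coef_b w).
  apply: bin_form_eq => i hi; rewrite /coef_b mxE inordK; last by lia.
  by do 3?[case: ifP; first by lia].
have vd : bin_form 4 (coef_d (unshear g w))
          = bin_form 4 (coef_d w) - g%:MP * bin_form 4 (coef_b w).
  rewrite /bin_form mulr_sumr -sumrB; apply: eq_bigr => i _.
  rewrite mul_mpolyC scalerA -scalerBl /coef_d mxE inordK; last by have := ltn_ord i; lia.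
  have hi := ltn_ord i.
  rewrite ifF; last by lia.
  rewrite ifF; last by lia.
  rewrite ifT; last by lia.
  (* The shift by 5 leads from the entry of d_i to that of b_i. *)
  by rewrite /coef_b (_ : 14 + i - 5 = 9 + i)%N //; lia.
have v0 : coef_c (unshear g w) 0 = coef_c w 0 by rewrite /coef_c mxE inordK.
have v1 : coef_c (unshear g w) 1 = coef_c w 1 - 2%:R * g * coef_c w 0.
  by rewrite {1}/coef_c mxE inordK.
have v2 : coef_c (unshear g w) 2 = 0 by rewrite {1}/coef_c mxE inordK.
have cE (v : 'rV[k]_22) : conic_bundle v =
    bin_form 8 (coef_a v) * y0 ^+ 2 + bin_form 4 (coef_b v) * (y0 * y1)
    + bin_form 4 (coef_d v) * (y0 * y2) + (coef_c v 0)%:MP * y1 ^+ 2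
    + (coef_c v 1)%:MP * (y1 * y2) + (coef_c v 2)%:MP * y2 ^+ 2.
  by rewrite !mul_mpolyC.
rewrite !cE v0 v1 v2 w2.
rewrite !(rmorphD (comp_mpoly s), rmorphXn (comp_mpoly s), rmorphM (comp_mpoly s)) /=.
rewrite !sbin !comp_mpolyC sy0 sy1 sy2 va vb vd.
rewrite !(mpolyCB, mpolyCM, rmorphXn (@mpolyC 5 k), mpolyC_nat, mpolyC0).
have expand (T : comNzRingType) (pa pb pd p0 p1 t0 t1 t2 c : T) :
  pa * t0 ^+ 2 + pb * (t0 * t1) + pd * (t0 * t2) + p0 * t1 ^+ 2 + p1 * (t1 * t2)
  + (c * p1 - c ^+ 2 * p0) * t2 ^+ 2
  = pa * t0 ^+ 2 + pb * (t0 * (t1 + c * t2)) + (pd - c * pb) * (t0 * t2)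
    + p0 * (t1 + c * t2) ^+ 2 + (p1 - 2%:R * c * p0) * ((t1 + c * t2) * t2)
    + 0 * t2 ^+ 2 by ring.
exact: expand.
Qed.



Lemma chi_image_split (w : 'rV[k]_22) g :
  coef_c w 1 != 0 -> coef_c w 2 = g * coef_c w 1 - g ^+ 2 * coef_c w 0 ->
  chi_image w.
Proof.
move=> w1 w2; exists (shear g), (unshear g w); split; last first.
  by exists 1; rewrite ?oner_eq0 // scale1r -conic_bundle_shear.
have u2 : coef_c (unshear g w) 2 = 0 by rewrite {1}/coef_c mxE inordK.
(* If the unsheared vector were 0, then c_0 = 0 and c_1 - 2 g c_0 = 0, so c_1 = 0. *)
split=> //; apply: contra_neq w1 => u0.
have /esym : coef_c (unshear g w) 0 = 0 by rewrite u0 /coef_c mxE.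
rewrite {1}/coef_c mxE inordK //= => c0.
have /esym : coef_c (unshear g w) 1 = 0 by rewrite u0 /coef_c mxE.
by rewrite {1}/coef_c mxE inordK //= /coef_c -c0 mulr0 subr0 => ->.
Qed.

(** Let p be G as a polynomial in c_2 alone. It vanishes at s(g) = g c_1 - g^2 c_0 for every g, so
    the composite of p with s is 0; as c_1 makes s nonconstant, p is 0. *)
Lemma meval_split_eq0 (G : {mpoly k[22]}) :
  (forall w : 'rV[k]_22, chi_image w -> G.@[fun i => w 0 i] = 0) ->
  forall w : 'rV[k]_22, coef_c w 1 != 0 -> G.@[fun i => w 0 i] = 0.
Proof.
move=> G0 w w1; pose i21 : 'I_22 := inord 21.
have [p pE] := meval_line G (fun i => if i == i21 then 0 else w 0 i)
  (fun i => (i == i21)%:R).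
pose r t : 'rV[k]_22 := \row_i if i == i21 then t else w 0 i.
have pr t : p.[t] = G.@[fun i => r t 0 i].
  rewrite pE; apply: meval_eq => i; rewrite mxE.
  by case: eqP => _; rewrite ?mulr1 ?add0r // mulr0 addr0.
have r0 t : coef_c (r t) 0 = coef_c w 0.
  by rewrite /coef_c mxE ifF // -val_eqE /= !inordK.
have r1 t : coef_c (r t) 1 = coef_c w 1.
  by rewrite /coef_c mxE ifF // -val_eqE /= !inordK.
have r2 t : coef_c (r t) 2 = t by rewrite /coef_c mxE eqxx.
pose s := coef_c w 1 *: 'X - coef_c w 0 *: 'X^2.
have ps0 : p \Po s = 0.
  apply: (@cofinite_roots_eq0 [::]) => g _; rewrite horner_comp pr; apply: G0.
  apply: (@chi_image_split _ g); rewrite ?r0 ?r1 ?r2 //.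
  by rewrite /s hornerD hornerN !hornerZ hornerX hornerXn [_ * g]mulrC [_ * g ^+ 2]mulrC.
have size_s : (1 < size s)%N.
  (* The coefficient of s in degree 1 is c_1. *)
  rewrite ltnNge; apply: contra w1 => size_s; apply/eqP.
  have <- : s`_1 = coef_c w 1 by rewrite coefB !coefZ coefX coefXn mulr1 mulr0 subr0.
  exact: nth_default.
move/eqP: ps0; rewrite comp_poly_eq0 // => /eqP p0.
have <- : p.[coef_c w 2] = G.@[fun i => w 0 i]; last by rewrite p0 horner0.
by rewrite pr; apply: meval_eq => i; rewrite mxE; case: eqP => // ->.
Qed.

Lemma chi_image_dense : zariski_dense (@chi_image k).
Proof.
move=> Z [I [_ ZI]] imZ v v0; apply/ZI; split=> // G IG.
have G0 (w : 'rV[k]_22) : coef_c w 1 != 0 -> G.@[fun i => w 0 i] = 0.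
  by apply: meval_split_eq0 => u /imZ /ZI [_]; apply.
pose i20 : 'I_22 := inord 20.
have [p pE] := meval_line G (fun i => v 0 i) (fun i => (i == i20)%:R).
have p0 : p = 0.
  (* Along the line through v that varies c_1, the excluded t is the one where c_1 becomes 0; v
     itself is the point t = 0. *)
  apply: (@cofinite_roots_eq0 [:: - coef_c v 1]) => t; rewrite inE => tv.
  pose w : 'rV[k]_22 := \row_i (v 0 i + t * (i == i20)%:R).
  rewrite pE -[RHS](G0 w); first by apply: meval_eq => i; rewrite mxE.
  by rewrite /coef_c mxE eqxx mulr1 addrC addr_eq0.
rewrite -[RHS](horner0 0) -p0 pE; apply: meval_eq => i.
by rewrite mul0r addr0.
Qed.

End Density.

(** * Rationality of the general member of the hyperplane *)

Lemma general_rational (k : fieldType) :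
  holds_generally_on (@calU k) (fun v => rational_surface (conic_bundle v)).
Proof.
pose X (i : nat) : {mpoly k[22]} := 'X_(inord i).
(* G is c_1 times c_1^2 a_0 - c_1 b_0 d_0 + c_0 d_0^2, so one quartic covers both nonvanishing
   conditions of [conic_bundle_rational]. *)
pose G : {mpoly k[22]} :=
  X 20%N * (X 20%N ^+ 2 * X 0%N - X 20%N * X 9%N * X 14%N + X 19%N * X 14%N ^+ 2).
have GE (v : 'rV[k]_22) : G.@[fun i => v 0 i] =
    coef_c v 1 * (coef_c v 1 ^+ 2 * coef_a v 0 - coef_c v 1 * coef_b v 0 * coef_d v 0
      + coef_c v 0 * coef_d v 0 ^+ 2).
  have hX i : (X i).@[fun i => v 0 i] = v 0 (inord i) by exact: mevalXU.
  have hX2 i : (X i ^+ 2).@[fun i => v 0 i] = v 0 (inord i) ^+ 2.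
    by rewrite rmorphXn /= hX.
  by rewrite /G mevalM mevalD mevalB !(hX2, hX, mevalM).
have homX i : X i \is 1.-homog by rewrite dhomogX /= mdeg1.
exists (fun v : 'rV[k]_22 => v != 0 /\ forall H, H = G -> H.@[fun i => v 0 i] = 0); split.
- exists (fun H => H = G); split=> [H ->|v]; last by [].
  have homX2 i : X i ^+ 2 \is 2.-homog := dhomogMn 2 (homX i).
  exists 4%N; apply: (dhomogM (homX 20%N)); apply: rpredD; first apply: rpredB.
  + exact: (dhomogM (homX2 20%N) (homX 0%N)).
  + exact: (dhomogM (dhomogM (homX 20%N) (homX 9%N)) (homX 14%N)).
  exact: (dhomogM (homX 19%N) (homX2 14%N)).
(* The witness with G nonzero is x0^8 y0^2 + y1 y2, that is a_0 = c_1 = 1. *)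
- pose v : 'rV[k]_22 := \row_i (((i == 0%N :> nat) || (i == 20%N :> nat))%:R).
  have va : coef_a v 0 = 1 by rewrite /coef_a mxE inordK.
  have vb : coef_b v 0 = 0 by rewrite /coef_b mxE inordK.
  have vd : coef_d v 0 = 0 by rewrite /coef_d mxE inordK.
  have v0 : coef_c v 0 = 0 by rewrite /coef_c mxE inordK.
  have v1 : coef_c v 1 = 1 by rewrite /coef_c mxE inordK.
  have v2 : coef_c v 2 = 0 by rewrite /coef_c mxE inordK.
  exists v.
    split=> //; apply: contra_neq (oner_neq0 k) => e.
    by rewrite -v1 e /coef_c mxE.
  move=> [_ /(_ G erefl)]; rewrite GE va vb vd v0 v1.
  rewrite !(mul1r, expr1n, mul0r, mulr0, subr0, addr0).
  by move/eqP; rewrite oner_eq0.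
move=> v [v0 v2] nZ; have : G.@[fun i => v 0 i] != 0.
  by apply/eqP => e; apply: nZ; split=> // H ->.
rewrite GE mulf_eq0 negb_or => /andP[v1 disc].
exact: conic_bundle_rational.
Qed.

Theorem proposition6p5 (k : fieldType) (k_infinite : infinite_field k)
    (k_C1 : C1_field k) (char_k_neq2 : 2%N \notin [pchar k]) :
  holds_generally_on (@calU k)
    (fun v => rational_surface (conic_bundle v)) /\
  zariski_dense (@chi_image k).
Proof. by split; [exact: general_rational|exact: chi_image_dense]. Qed.
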